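(* Let $D\subset\mathbb{R}^d$ be a compact set whose convex hull contains the origin in its interior. Let $s_n=x_1+\dots+x_n$, $n=1,2,\dots$, be a $d$-dimensional (measure-theoretic) martingale with respect to a filtration $\{\mathcal F_n\}$ on a probability space, whose differences satisfy $x_n\in D$ almost everywhere for all $n$ (so they are uniformly bounded). Let $V_n=\sum_{i=1}^n x_ix_i^{\mathrm t}$, so $\operatorname{tr}V_n=\sum_{i=1}^n\|x_i\|^2$. Then with probability one the sequence $$\frac{\|s_n\|}{\sqrt{\max\bigl(1,\ \operatorname{tr}V_n\,\log(\operatorname{tr}V_n)\bigr)}},\qquad n=1,2,\dots,$$ is bounded.
   Context: $\|\cdot\|$ is the Euclidean norm on $\mathbb{R}^d$. Convention: $0\log 0=0$. No assumption is made on the growth of $\operatorname{tr}V_n$, which may be random. *)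

(* Defs.v *)
From HB Require Import structures.
From mathcomp Require Import all_boot all_order all_algebra.
From mathcomp Require Import all_classical all_reals all_analysis.
Import Order.TTheory GRing.Theory Num.Theory.
Import numFieldNormedType.Exports.

Set Implicit Arguments.
Unset Strict Implicit.
Unset Printing Implicit Defensive.

Local Open Scope classical_set_scope.
Local Open Scope ring_scope.

(* The norm that the library puts on ['cV[R]_d] is the maximum norm; it induces
   the same topology as [enorm], so [compact] and [interior] are the usual
   notions on Euclidean space. *)
Definition enorm (R : realType) (d : nat) (v : 'cV[R]_d) : R :=
  Num.sqrt (\sum_(i < d) v i 0 ^+ 2).

Definition convex_hull (R : realType) (d : nat) (D : set 'cV[R]_d) :
    set 'cV[R]_d :=
  smallest (@convex_set R 'cV[R]_d) D.

Section martingales.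
Context (disp : measure_display) (T : measurableType disp) (R : realType)
  (P : probability T R).

Definition filtration (F : nat -> set (set T)) : Prop :=
  [/\ forall n, sigma_algebra setT (F n),
      forall n, F n `<=` measurable &
      forall m n, (m <= n)%N -> F m `<=` F n].

Definition measurable_wrt (G : set (set T)) (f : T -> R) : Prop :=
  preimage_set_system setT f measurable `<=` G.

(* [Y] is a version of the conditional expectation of [X] given [G]. *)
Definition is_cond_exp (G : set (set T)) (X Y : T -> R) : Prop :=
  [/\ measurable_wrt G Y,
      P.-integrable setT (EFin \o Y) &
      forall A, G A ->
        (\int[P]_(w in A) (Y w)%:E = \int[P]_(w in A) (X w)%:E)%E].

(* Vector-valued notions are taken coordinatewise. *)
Definition martingale (d : nat) (F : nat -> set (set T))
    (s : nat -> T -> 'cV[R]_d) : Prop :=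
  [/\ forall n i, measurable_wrt (F n) (fun w => s n w i 0),
      forall n i, P.-integrable setT (fun w => (s n w i 0)%:E) &
      forall n i,
        is_cond_exp (F n) (fun w => s n.+1 w i 0) (fun w => s n w i 0)].

End martingales.

(* Time is shifted by one: index [n : nat] stands for the time [n + 1], so that
   [x 0] is the first increment and [psum x 0 = x 0] the first term of the
   martingale (in particular [x 0] need not be centred). *)
Definition psum (T : Type) (R : realType) (d : nat) (x : nat -> T -> 'cV[R]_d)
    (n : nat) (w : T) : 'cV[R]_d :=
  \sum_(i < n.+1) x i w.

Definition sqvar (T : Type) (R : realType) (d : nat) (x : nat -> T -> 'cV[R]_d)
    (n : nat) (w : T) : 'M[R]_d :=
  \sum_(i < n.+1) x i w *m (x i w)^T.

(* Main.v *)
(** Work coordinatewise: it suffices to treat a scalar martingale [s_n] with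
    increments [y_n] bounded by [c] and [V_n = sum y_i^2], since
    [max 1 (t log t)] is nondecreasing in [t].  From
    [exp (y - 2 y^2) <= 1 + y] for [y >= -1/2], the process
    [exp (l s_n - 2 l^2 V_n)] is a supermartingale when [|l| c <= 1/2], and its
    maximal inequality bounds the probability that it ever reaches [e^k] by
    [2 e^-k].  Borel-Cantelli applied to rates [l_k] proportional to
    [sqrt (k e^-k)] then gives [l_k s_n - 2 l_k^2 V_n <= k] for all [n] and all
    large [k]; choosing [k] close to [log V_n] yields
    [s_n = O (sqrt (V_n log V_n))], and [- s_n] is treated with [- l_k]. *)
Require Import Defs.
From mathcomp Require Import all_boot all_order all_algebra.
From mathcomp Require Import all_classical all_reals all_analysis.
From mathcomp Require Import measurable_realfun ring lra.
Import Order.TTheory GRing.Theory Num.Theory.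
Import numFieldNormedType.Exports.

Set Implicit Arguments.
Unset Strict Implicit.
Unset Printing Implicit Defensive.

Local Open Scope classical_set_scope.
Local Open Scope ring_scope.

(** The reciprocal of the left side is at least [1 - y + 2 y^2], and [(1 + y) (1 - y + 2 y^2) = 1 +
    y^2 (1 + 2 y)] is at least 1 for such [y]. *)
Lemma expR_subsq_le (R : realType) (y : R) :
  - 2^-1 <= y -> expR (y - 2 * y ^+ 2) <= 1 + y.
Proof.
move=> y2; rewrite -[y - _]opprK expRN.
have h : 0 < 1 - y + 2 * y ^+ 2 by nra.
have e : 1 - y + 2 * y ^+ 2 <= expR (- (y - 2 * y ^+ 2)).
  by apply: le_trans (expR_ge1Dx _); lra.
rewrite -[_^-1]mul1r ler_pdivrMr ?expR_gt0//.
have y1 : 0 <= 1 + y by lra.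
apply: le_trans (ler_wpM2l y1 e); nra.
Qed.

Lemma bounded_funW (T : Type) (R : realType) (f : T -> R) (B : R) :
  (forall w, `|f w| <= B) -> bounded_fun f.
Proof.
move=> fB; exists B; split; first exact: num_real.
by move=> M BM w _; exact: le_trans (fB w) (ltW BM).
Qed.

(** * Orthogonality of centred variables to bounded [G]-measurable factors *)

Section sub_sigma_algebra.
Context (disp : measure_display) (T : measurableType disp) (R : realType)
  (P : probability T R) (G : set (set T)).
Hypothesis Gsigma : sigma_algebra setT G.
Hypothesis Gmeas : G `<=` measurable.

Lemma measurable_wrtE (f : T -> R) :
  measurable_wrt G f <->
  measurable_fun setT (f : g_sigma_algebraType G -> R).
Proof.
split => [fG _ Y mY|mf A [Y mY <-]].
  by rewrite /measurable/= sigma_algebra_id//; apply: fG; exists Y.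
by have := mf measurableT Y mY; rewrite /measurable/= sigma_algebra_id.
Qed.

Lemma measurable_wrt_measurable (f : T -> R) :
  measurable_wrt G f -> measurable_fun setT f.
Proof. by move=> fG _ Y mY; apply: Gmeas; apply: fG; exists Y. Qed.

Lemma integrableM_bounded (x g : T -> R) (B : R) :
  P.-integrable setT (EFin \o x) -> measurable_fun setT g ->
  (forall w, `|g w| <= B) ->
  P.-integrable setT (EFin \o (fun w => g w * x w)).
Proof.
move=> ix mg gB.
exact: (integrableMr measurableT mg (bounded_funW gB) ix).
Qed.

(* Subtracting [B / 2] times the indicator of [B / 2 <= g] changes neither the
   integral of [g * x] nor the hypotheses on [g], and halves the bound [B]. *)
Lemma Rintegral_mul_halving (x g : T -> R) (B : R) (m : nat) :
  P.-integrable setT (EFin \o x) ->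
  (forall A, G A -> \int[P]_(w in A) x w = 0) ->
  measurable_wrt G g -> (forall w, 0 <= g w <= B) ->
  `|\int[P]_w (g w * x w)| <= B / 2 ^+ m * \int[P]_w `|x w|.
Proof.
move=> ix x0; have mx := measurable_int _ ix.
elim: m g B => [|m IH] g B Gg gB.
  have mg := measurable_wrt_measurable Gg.
  have gB' w : `|g w| <= B by have /andP[? ?] := gB w; rewrite ger0_norm.
  have igx := integrableM_bounded ix mg gB'.
  rewrite expr0 divr1; apply: le_trans (le_normr_Rintegral _ igx) _ => //.
  have inx := integrable_norm ix.
  rewrite -RintegralZl//; apply: le_Rintegral => //.
  - exact: integrable_norm igx.
  - exact: (@integrableZl _ _ _ _ _ measurableT B _ inx).
  - by move=> w _; rewrite normrM ler_wpM2r.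
pose A := [set w | B / 2 <= g w].
have GA : G A.
  have -> : A = setT `&` g @^-1` `[B / 2, +oo[.
    by rewrite setTI; apply/seteqP; split => w; rewrite /A/= in_itv/= andbT.
  by apply: Gg; exists `[B / 2, +oo[%classic.
have mA : measurable A by exact: Gmeas.
pose g' w := g w - B / 2 * \1_A w.
have g'B w : 0 <= g' w <= B / 2.
  rewrite /g' indicE; case: (boolP (w \in A)); rewrite ?inE /A/= => h.
    by have := gB w; lra.
  move: h; rewrite notin_setE/= => /negP; rewrite -ltNge => h.
  by have := gB w; lra.
have Gg' : measurable_wrt G g'.
  apply/measurable_wrtE; apply: measurable_funB; first exact/measurable_wrtE.
  apply: measurable_funM => //; apply: measurable_indic.
  by rewrite /measurable/= sigma_algebra_id.
have mg' := measurable_wrt_measurable Gg'.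
have ig'x : P.-integrable setT (EFin \o (fun w => g' w * x w)).
  apply: (integrableM_bounded (B := B / 2)) => // w.
  by have /andP[? ?] := g'B w; rewrite ger0_norm.
have iAx : P.-integrable setT (EFin \o (fun w => \1_A w * x w)).
  apply: (integrableM_bounded (B := 1)) => //.
  by move=> w; rewrite indicE; case: (w \in A); rewrite ?normr1 ?normr0.
have -> : \int[P]_w (g w * x w) = \int[P]_w (g' w * x w).
  transitivity (\int[P]_w (g' w * x w + B / 2 * (\1_A w * x w))).
    by apply: eq_Rintegral => w _; rewrite /g'; ring.
  rewrite RintegralD//; 
    last exact: (@integrableZl _ _ _ _ _ measurableT (B / 2) _ iAx).
  rewrite RintegralZl//.
  have -> : \int[P]_w (\1_A w * x w) = \int[P]_(w in A) x w.
    rewrite [RHS]Rintegral_mkcond; apply: eq_Rintegral => w _.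
    by rewrite patchE indicE; case: ifP; rewrite ?mul1r ?mul0r.
  by rewrite x0// mulr0 addr0.
by apply: le_trans (IH _ _ Gg' g'B) _; rewrite exprS invfM mulrA.
Qed.

(** The halving bound holds for every [m] and tends to 0. This is the pull-out property of
    conditional expectation in the form used for the supermartingale. *)
Lemma Rintegral_mul_eq0 (x g : T -> R) (B : R) :
  P.-integrable setT (EFin \o x) ->
  (forall A, G A -> \int[P]_(w in A) x w = 0) ->
  measurable_wrt G g -> (forall w, 0 <= g w <= B) ->
  \int[P]_w (g w * x w) = 0.
Proof.
move=> ix x0 Gg gB; apply/eqP; rewrite -normr_le0; apply/ler_addgt0Pr => e e0.
set C := B * \int[P]_w `|x w|.
(* This number [m] of halvings suffices because [C / e < m <= 2 ^ m]. *)
have := @Rintegral_mul_halving _ _ _ (Num.trunc (C / e)).+1 ix x0 Gg gB.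
move=> /le_trans; apply; rewrite add0r mulrAC ler_pdivrMr ?exprn_gt0// -/C.
rewrite -ler_pdivrMl// mulrC.
apply: (@le_trans _ _ (Num.trunc (C / e)).+1%:R).
  exact/ltW/truncnS_gt.
by rewrite -natrX ler_nat ltnW// ltn_expl.
Qed.

End sub_sigma_algebra.

(** The difference [g - f] agrees almost everywhere with its absolute value, whose integral is
    nonnegative. *)
Lemma ae_le_Rintegral (disp : measure_display) (T : measurableType disp)
    (R : realType) (mu : {measure set T -> \bar R}) (f g : T -> R) :
  mu.-integrable setT (EFin \o f) -> mu.-integrable setT (EFin \o g) ->
  {ae mu, forall w, f w <= g w} ->
  \int[mu]_w f w <= \int[mu]_w g w.
Proof.
move=> if_ ig fg; rewrite -subr_ge0 -RintegralB//.
have mf : measurable_fun setT f by apply/measurable_EFinP; exact: measurable_int if_.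
have mg : measurable_fun setT g by apply/measurable_EFinP; exact: measurable_int ig.
have -> : \int[mu]_w (g w - f w) = \int[mu]_w `|g w - f w|;
  last exact: Rintegral_ge0.
congr fine; apply: ae_eq_integral => //.
- by apply/measurable_EFinP; exact: measurable_funB.
- apply/measurable_EFinP; apply: measurableT_comp; first exact: normr_measurable.
  exact: measurable_funB.
- by apply: filterS fg => w fgw _; rewrite ger0_norm// subr_ge0.
Qed.

(** * The exponential supermartingale and its maximal inequality *)

Section exponential_bound.
Context (disp : measure_display) (T : measurableType disp) (R : realType)
  (P : probability T R) (F : nat -> set (set T)) (y : nat -> T -> R) (c : R).
Hypothesis filtrF : filtration F.
Hypothesis adapted_y : forall n, measurable_wrt (F n) (y n).
Hypothesis integrable_y : forall n, P.-integrable setT (EFin \o y n).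
Hypothesis mean0_y :
  forall n A, F n A -> \int[P]_(w in A) y n.+1 w = 0.
Hypothesis y_bounded : forall n, {ae P, forall w, `|y n w| <= c}.

Definition exp_step (l : R) (n : nat) (w : T) : R :=
  expR (l * y n w - 2 * (l * y n w) ^+ 2).

(* The process [exp_process] below, frozen once it reaches [a]. *)
Fixpoint stopped_exp (l a : R) (n : nat) (w : T) : R :=
  if n is m.+1 then
    let X := stopped_exp l a m w in
    if a <= X then X else X * exp_step l n w
  else exp_step l 0 w.

Let Fsigma n : sigma_algebra setT (F n). Proof. by case: filtrF. Qed.
Let Fmeas n : F n `<=` measurable. Proof. by case: filtrF => _ /(_ n). Qed.

Lemma measurable_wrt_filtration m n (f : T -> R) :
  (m <= n)%N -> measurable_wrt (F m) f -> measurable_wrt (F n) f.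
Proof. by move=> mn mf; apply: subset_trans mf _; case: filtrF => _ _; apply. Qed.

Lemma measurable_exp_step l n : measurable_wrt (F n) (exp_step l n).
Proof.
apply/(measurable_wrtE (Fsigma n)); apply: measurableT_comp => //.
have mly : measurable_fun setT (fun w : g_sigma_algebraType (F n) => l * y n w).
  apply: measurable_funM => //.
  exact/(measurable_wrtE (Fsigma n)).
apply: measurable_funB => //; apply: measurable_funM => //.
exact: measurable_funX.
Qed.

Lemma exp_step_ge0 l n w : 0 <= exp_step l n w.
Proof. exact: expR_ge0. Qed.

(** The exponent [t - 2 t^2] is at most 1 for every real [t], so the bound is pointwise and does not
    depend on [l]. *)
Lemma exp_step_le l n w : exp_step l n w <= expR 1.
Proof. by rewrite ler_expR; set t := l * _; nra. Qed.

Lemma stopped_exp_ge0 l a n w : 0 <= stopped_exp l a n w.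
Proof.
elim: n => [|n IH] /=; first exact: exp_step_ge0.
by case: ifP => // _; rewrite mulr_ge0// exp_step_ge0.
Qed.

(** A value below [a] can overshoot by one factor only, at most [e]; the extra 1 covers the initial
    step, which has no predecessor below [a]. *)
Lemma stopped_exp_le l a n w : 0 <= a -> stopped_exp l a n w <= (a + 1) * expR 1.
Proof.
move=> a0; elim: n => [|n IH] /=.
  by apply: le_trans (exp_step_le _ _ _) _; rewrite ler_peMl ?expR_ge0// lerDr.
case: (leP a) => // Xa; apply: ler_pM.
- exact: stopped_exp_ge0.
- exact: exp_step_ge0.
- by rewrite (le_trans (ltW Xa))// lerDl.
- exact: exp_step_le.
Qed.

Lemma measurable_stopped_exp l a n : measurable_wrt (F n) (stopped_exp l a n).
Proof.
elim: n => [|n IH] /=; first exact: measurable_exp_step.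
have mX : measurable_fun setT
    (stopped_exp l a n : g_sigma_algebraType (F n.+1) -> R).
  apply/(measurable_wrtE (Fsigma n.+1)).
  exact: measurable_wrt_filtration IH.
apply/(measurable_wrtE (Fsigma n.+1)); apply: measurable_fun_ifT => //.
- exact: measurable_fun_ler.
- apply: measurable_funM => //.
  exact/(measurable_wrtE (Fsigma n.+1))/measurable_exp_step.
Qed.

Lemma integrable_stopped_exp l a n :
  0 <= a -> P.-integrable setT (EFin \o stopped_exp l a n).
Proof.
move=> a0; apply: measurable_bounded_integrable => //.
- by rewrite (le_lt_trans (probability_le1 _ _))// ltry.
- exact: (measurable_wrt_measurable (@Fmeas n) (@measurable_stopped_exp l a n)).
- apply: bounded_funW => w; rewrite ger0_norm ?stopped_exp_ge0//.
  exact: stopped_exp_le.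
Qed.

Lemma exp_step_le_affine l n : `|l| * c <= 2^-1 ->
  {ae P, forall w, exp_step l n w <= 1 + l * y n w}.
Proof.
move=> lc; apply: filterS (y_bounded n) => w yc.
have : `|l * y n w| <= 2^-1.
  by rewrite normrM (le_trans _ lc)// ler_wpM2l.
by rewrite ler_norml => /andP[? _]; exact: expR_subsq_le.
Qed.

Lemma Rintegral_stopped_exp l a n : `|l| * c <= 2^-1 -> 0 <= a ->
  \int[P]_w stopped_exp l a n w <= 2.
Proof.
move=> lc a0; elim: n => [|n IH] /=.
  (* The first increment need not be centred, so only [1 + l * y 0 w <= 3/2] is available; hence the
     bound 2 instead of 1. *)
  apply: (@le_trans _ _ (\int[P]_w (2:R))); last first.
    by rewrite Rintegral_cst// [X in fine X]probability_setT mulr1.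
  apply: ae_le_Rintegral.
  - exact: (integrable_stopped_exp l 0 a0).
  - exact: finite_measure_integrable_cst.
  apply: filterS2 (exp_step_le_affine 0 lc) (y_bounded 0) => w h yc.
  apply: le_trans h _; have : `|l * y 0 w| <= 2^-1.
    by rewrite normrM (le_trans _ lc)// ler_wpM2l.
  by rewrite ler_norml; lra.
apply: le_trans IH.
(* The active part of the process: it is [F n]-measurable with values in [[0, a]], hence orthogonal
   to [y n.+1], and the next stopped value is at most [stopped_exp l a n w + l * (g w * y n.+1 w)]
   almost everywhere. *)
pose g w := if a <= stopped_exp l a n w then 0 else stopped_exp l a n w.
have g_bd w : 0 <= g w <= a.
  rewrite /g; case: (leP a) => [_|Xa]; first by rewrite lexx.
  by rewrite stopped_exp_ge0 ltW.
have mX : measurable_fun setT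
    (stopped_exp l a n : g_sigma_algebraType (F n) -> R).
  exact/(measurable_wrtE (Fsigma n))/measurable_stopped_exp.
have mg : measurable_wrt (F n) g.
  apply/(measurable_wrtE (Fsigma n)); apply: measurable_fun_ifT => //.
  exact: measurable_fun_ler.
have igy : P.-integrable setT (EFin \o (fun w => g w * y n.+1 w)).
  apply: (integrableM_bounded (B := a)) => //.
    exact: (measurable_wrt_measurable (@Fmeas n) mg).
  by move=> w; have /andP[? ?] := g_bd w; rewrite ger0_norm.
have ilgy : P.-integrable setT (EFin \o (fun w => l * (g w * y n.+1 w))).
  exact: (@integrableZl _ _ _ _ _ measurableT l _ igy).
have iX := integrable_stopped_exp l n a0.
apply: (@le_trans _ _
  (\int[P]_w (stopped_exp l a n w + l * (g w * y n.+1 w)))); last first.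
  rewrite RintegralD// RintegralZl//.
  rewrite (Rintegral_mul_eq0 (Fsigma n) (@Fmeas n) _ _ mg g_bd)//.
    by rewrite mulr0 addr0.
  exact: mean0_y.
apply: ae_le_Rintegral.
- exact: (integrable_stopped_exp l n.+1 a0).
- exact: (@integrableD _ _ _ _ _ measurableT _ _ iX ilgy).
apply: filterS (exp_step_le_affine n.+1 lc) => w h; rewrite /g.
case: (leP a) => _; first by rewrite mul0r mulr0 addr0.
rewrite mulrCA -{2}[stopped_exp _ _ _ _]mulr1 -mulrDr.
by rewrite ler_wpM2l// stopped_exp_ge0.
Qed.

Lemma stopped_exp_markov l a n : `|l| * c <= 2^-1 -> 0 < a ->
  (P [set w | (a <= stopped_exp l a n w)%R] <= (2 / a)%:E)%E.
Proof.
move=> lc a0.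
have iX := integrable_stopped_exp l n (ltW a0).
have mX := measurable_int _ iX.
have := le_integral_abse P measurableT mX a0.
have -> : [set: T] `&` [set x | (a%:E <= `|(EFin \o stopped_exp l a n) x|)%E]
    = [set w | a <= stopped_exp l a n w].
  rewrite setTI; apply/seteqP; split => w /=.
    by rewrite lee_fin ger0_norm ?stopped_exp_ge0.
  by rewrite lee_fin ger0_norm ?stopped_exp_ge0.
have -> : (\int[P]_x `|(EFin \o stopped_exp l a n) x| =
           (\int[P]_x stopped_exp l a n x)%:E)%E.
  rewrite /Rintegral fineK; last exact: integrable_fin_num iX.
  by apply: eq_integral => w _ /=; rewrite ger0_norm ?stopped_exp_ge0.
move=> h; rewrite EFinM muleC lee_pdivlMl//.
by apply: le_trans h _; rewrite lee_fin; exact: Rintegral_stopped_exp (ltW a0).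
Qed.

Definition exp_process (l : R) (n : nat) (w : T) : R :=
  expR (l * (\sum_(i < n.+1) y i w) - 2 * l ^+ 2 * (\sum_(i < n.+1) y i w ^+ 2)).

Lemma exp_processS l n w :
  exp_process l n.+1 w = exp_process l n w * exp_step l n.+1 w.
Proof.
rewrite /exp_process /exp_step -expRD; congr expR.
by rewrite (big_ord_recr n.+1)/= [in X in _ - X](big_ord_recr n.+1)/=; ring.
Qed.

(** The two processes agree until the stopped one freezes, and it freezes only at a value at least
    [a]. *)
Lemma stopped_exp_exceed l a n w :
  a <= exp_process l n w -> a <= stopped_exp l a n w.
Proof.
have : (a <= stopped_exp l a n w) || (stopped_exp l a n w == exp_process l n w).
  elim: n => [|n IH] /=.
    apply/orP; right; apply/eqP.
    by rewrite /exp_step /exp_process !big_ord1; congr expR; ring.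
  case: (leP a) IH => [aX _|_ /= /eqP ->]; first by rewrite aX.
  by rewrite -exp_processS eqxx orbT.
by case/orP => [//|/eqP ->].
Qed.

(** By freezing, the events that the stopped process is at least [a] at time [n] increase with [n],
    so Markov's bound at each fixed time passes to their union. *)
Lemma exp_process_maximal l a : `|l| * c <= 2^-1 -> 0 < a ->
  exists A, [/\ measurable A,
    forall n w, a <= exp_process l n w -> A w & (P A <= (2 / a)%:E)%E].
Proof.
move=> lc a0; pose B n := [set w | a <= stopped_exp l a n w].
have mB n : measurable (B n).
  rewrite -[B n]setTI; apply: measurable_fun_le => //.
  exact: (measurable_wrt_measurable (@Fmeas n) (@measurable_stopped_exp l a n)).
have ndB : {homo B : n m / (n <= m)%N >-> (n <= m)%O}.
  apply: homo_leq => [X|X Y Z|n]; rewrite ?lexx//; first exact: le_trans.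
  by apply/subsetPset => w; rewrite /B /= => aX; rewrite aX.
have mU : measurable (\bigcup_n B n) by exact: bigcup_measurable.
exists (\bigcup_n B n); split => //.
  by move=> n w /stopped_exp_exceed aX; exists n.
have cv := @nondecreasing_cvg_mu _ _ _ P _ mB mU ndB.
rewrite -(cvg_lim _ cv)//; apply: lime_le; first exact: cvgP cv.
by apply: nearW => n; exact: stopped_exp_markov.
Qed.

End exponential_bound.

(** * Choice of rates and the deterministic growth bound *)

Lemma natr_le_expR (R : realType) (k : nat) : k%:R <= expR k%:R :> R.
Proof. by apply: le_trans (expR_ge1Dx _); rewrite lerDr. Qed.

(** This is [delta * sqrt (k e^-k)], written through the scale [sqrt (k e^k)] that [s n] is compared
    with when [V n] is about [e^k]. *)
Definition exp_rate (R : realType) (delta : R) (k : nat) : R :=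
  delta * Num.sqrt (k%:R * expR k%:R) * expR (- k%:R).

Lemma exp_rate_ge0 (R : realType) (delta : R) k :
  0 <= delta -> 0 <= exp_rate delta k.
Proof. by move=> d0; rewrite mulr_ge0 ?expR_ge0// mulr_ge0. Qed.

Lemma exp_rate_le (R : realType) (delta : R) k :
  0 <= delta -> exp_rate delta k <= delta.
Proof.
move=> d0; rewrite /exp_rate -mulrA ler_piMr// expRN ler_pdivrMr ?expR_gt0//.
rewrite mul1r -[leRHS](ger0_norm (expR_ge0 _)) -sqrtr_sqr ler_wsqrtr//.
by rewrite expr2 ler_wpM2r ?expR_ge0// natr_le_expR.
Qed.

(* At time [n] use the rate of index [k] with [e^k <= V n < e^(k+1)], for which
   both [k / exp_rate delta k] and [exp_rate delta k * V n] are of the order of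
   [sqrt (k e^k)]. *)
Lemma exp_rate_bound (R : realType) (delta : R) (s V : nat -> R) (K : nat) :
  0 < delta ->
  (forall k n, (K <= k)%N ->
     exp_rate delta k * s n <= k%:R + 2 * exp_rate delta k ^+ 2 * V n) ->
  exists2 C, 0 <= C & forall n, s n <= C * Num.sqrt (Num.max 1 (V n * ln (V n))).
Proof.
move=> d0 sV; pose u k : R := Num.sqrt (k%:R * expR k%:R).
have uC k : (0 < k)%N -> 0 < k%:R * expR k%:R :> R.
  by move=> k0; rewrite mulr_gt0 ?expR_gt0// ltr0n.
(* Dividing the hypothesis by the rate turns [k] into [u k / delta], and the quadratic term into at
   most [2 * delta * e * u k]. Starting at [K.+1] keeps [k], hence the rate, positive. *)
have bound k n : (K.+1 <= k)%N -> V n <= expR k.+1%:R ->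
    s n <= (delta^-1 + 2 * delta * expR 1) * u k.
  move=> Kk Vk; have k0 : (0 < k)%N by exact: leq_trans Kk.
  have u0 : 0 < u k by rewrite sqrtr_gt0 uC.
  have r0 : 0 < exp_rate delta k by rewrite !mulr_gt0 ?expR_gt0.
  rewrite -(ler_pM2l r0); apply: le_trans (sV _ _ (ltnW Kk)) _.
  have rE : exp_rate delta k * expR k%:R = delta * u k.
    by rewrite /exp_rate -mulrA -expRD addNr expR0 mulr1.
  have ru : exp_rate delta k * u k = delta * k%:R.
    rewrite /exp_rate -/(u k).
    transitivity (delta * u k ^+ 2 * expR (- k%:R)); first by ring.
    rewrite sqr_sqrtr ?ltW ?uC// -!mulrA -expRD subrr expR0 mulr1.
    by [].
  have -> : exp_rate delta k * ((delta^-1 + 2 * delta * expR 1) * u k) =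
      k%:R + 2 * exp_rate delta k ^+ 2 * expR k.+1%:R.
    rewrite -[k.+1]addn1 natrD expRD mulrDl mulrDr; congr (_ + _).
      by rewrite mulrCA ru mulKf// gt_eqF.
    transitivity (2 * exp_rate delta k * (delta * u k) * expR 1); first by ring.
    by rewrite -rE; ring.
  by rewrite lerD2l ler_wpM2l// mulr_ge0// sqr_ge0.
pose B := delta^-1 + 2 * delta * expR 1.
have B0 : 0 <= B by rewrite addr_ge0 ?invr_ge0 ?mulr_ge0 ?expR_ge0// ltW.
have u1 : 1 <= u K.+1.
  rewrite -sqrtr1; apply: ler_wsqrtr; rewrite -[leLHS]mulr1.
  apply: ler_pM => //; first by rewrite ler1n.
  by rewrite (le_trans _ (expR_ge1Dx _))// lerDl.
(* The factor [u K.+1], at least 1, absorbs all [n] with [V n <= e^(K+1)], where the maximum is only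
   known to be at least 1. *)
exists (B * u K.+1); first by rewrite mulr_ge0// sqrtr_ge0.
move=> n.
have m1 : 1 <= Num.sqrt (Num.max 1 (V n * ln (V n))).
  by rewrite -[leLHS]sqrtr1; apply: ler_wsqrtr; rewrite le_max lexx.
have [VK|KV] := leP (V n) (expR K.+1%:R).
  apply: (@le_trans _ _ (B * u K.+1)).
    by apply: bound => //; apply: le_trans VK _; rewrite ler_expR ler_nat.
  by rewrite ler_peMr// mulr_ge0// sqrtr_ge0.
have V0 : 0 < V n by apply: lt_trans KV; exact: expR_gt0.
have lnV : K.+1%:R < ln (V n) by rewrite -ltr_expR lnK.
have lnV0 : 0 <= ln (V n) by apply: le_trans (ltW lnV).
pose k := Num.trunc (ln (V n)).
have /andP[kl lk] := truncn_itv lnV0; rewrite -/k in kl lk.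
apply: (@le_trans _ _ (B * u k)).
  apply: bound.
    by rewrite -ltnS -(ltr_nat R); exact: lt_trans lk.
  by rewrite -[leLHS]lnK// ler_expR ltW.
rewrite -mulrA ler_wpM2l//.
apply: (@le_trans _ _ (Num.sqrt (Num.max 1 (V n * ln (V n))))); last first.
  by rewrite ler_peMl// sqrtr_ge0.
(* With [k] the integer part of [ln (V n)], both [k <= ln (V n)] and [e^k <= V n] hold. *)
apply: ler_wsqrtr; rewrite le_max; apply/orP; right.
by rewrite mulrC ler_pM ?expR_ge0// -[leRHS]lnK// ler_expR.
Qed.

(** * Borel-Cantelli and the scalar martingale *)

Section almost_sure_bound.
Context (disp : measure_display) (T : measurableType disp) (R : realType)
  (P : probability T R) (F : nat -> set (set T)).
Hypothesis filtrF : filtration F.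

Lemma exp_process_eventually_le (y : nat -> T -> R) (c : R) (l : nat -> R) :
  (forall n, measurable_wrt (F n) (y n)) ->
  (forall n, P.-integrable setT (EFin \o y n)) ->
  (forall n A, F n A -> \int[P]_(w in A) y n.+1 w = 0) ->
  (forall n, {ae P, forall w, `|y n w| <= c}) ->
  (forall k, `|l k| * c <= 2^-1) ->
  {ae P, forall w, exists K, forall k n, (K <= k)%N ->
     exp_process y (l k) n w <= expR k%:R}.
Proof.
move=> my iy y0 yc lc.
have /choice[A /all_and3[mA ltA PA]] k :=
  exp_process_maximal filtrF my iy y0 yc (lc k) (expR_gt0 k%:R).
have A0 : P (lim_sup_set A) = 0%E.
  apply: lim_sup_set_cvg0 => //.
  (* Since [2 <= e], the probabilities [2 e^-k] are dominated by a geometric series of ratio 1/2,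
     written as [4 / 2^(k+1)]. *)
  apply: (@le_lt_trans _ _ (\sum_(0 <= k <oo) (4 / (2 ^ (k + 1))%:R)%:E)%E).
    apply: lee_nneseries => // k _; apply: le_trans (PA k) _.
    rewrite lee_fin natrX exprD expr1 invfM mulrA.
    have -> : 4 / 2 ^+ k / 2 = 2 / 2 ^+ k :> R by field.
    rewrite ler_pM2l// lef_pV2 ?posrE ?expR_gt0 ?exprn_gt0//.
    rewrite -[k%:R]mulr1 mulrC expRM_natr lerXn2r// ?nnegrE ?expR_ge0//.
    exact: expR_ge1Dx.
  have h := @cvg_geometric_eseries_half R 4 0.
  by rewrite (cvg_lim _ h)// ltry.
exists (lim_sup_set A); split => //.
  by apply: bigcap_measurable => // n _; apply: bigcup_measurable.
move=> w /= nA K _; apply: contrapT => h.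
apply: nA; exists K => k n Kk; rewrite leNgt; apply/negP => /ltW lA.
by apply: h; exists k => //; exact: ltA lA.
Qed.

Lemma martingale_diff_bound (y : nat -> T -> R) (c : R) :
  0 < c ->
  (forall n, measurable_wrt (F n) (y n)) ->
  (forall n, P.-integrable setT (EFin \o y n)) ->
  (forall n A, F n A -> \int[P]_(w in A) y n.+1 w = 0) ->
  (forall n, {ae P, forall w, `|y n w| <= c}) ->
  {ae P, forall w, exists2 C, 0 <= C & forall n,
     let V := \sum_(i < n.+1) y i w ^+ 2 in
     `|\sum_(i < n.+1) y i w| <= C * Num.sqrt (Num.max 1 (V * ln V))}.
Proof.
(* Every rate is at most [delta], so this value ensures the smallness condition [|l| * c <= 1/2] for
   all [k] and both signs. *)
move=> c0 my iy y0 yc; pose delta := (2 * c)^-1.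
have d0 : 0 < delta by rewrite invr_gt0 mulr_gt0.
have rc k : `|exp_rate delta k| * c <= 2^-1.
  rewrite ger0_norm ?exp_rate_ge0 ?(ltW d0)//.
  apply: (@le_trans _ _ (delta * c)); first by rewrite ler_wpM2r ?exp_rate_le ?(ltW d0) ?(ltW c0).
  by rewrite /delta invfM -mulrA mulVf ?mulr1// gt_eqF.
have rNc k : `|- exp_rate delta k| * c <= 2^-1 by rewrite normrN.
apply: filterS2 (exp_process_eventually_le my iy y0 yc rc)
  (exp_process_eventually_le my iy y0 yc rNc) => w [K1 h1] [K2 h2].
have [C1 C10 H1] : exists2 C, 0 <= C & forall n,
    let V := \sum_(i < n.+1) y i w ^+ 2 in
    \sum_(i < n.+1) y i w <= C * Num.sqrt (Num.max 1 (V * ln V)).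
  apply: (exp_rate_bound (K := K1) d0) => k n /h1 - /(_ n).
  by rewrite ler_expR lerBlDr.
have [C2 C20 H2] : exists2 C, 0 <= C & forall n,
    let V := \sum_(i < n.+1) y i w ^+ 2 in
    - \sum_(i < n.+1) y i w <= C * Num.sqrt (Num.max 1 (V * ln V)).
  apply: (exp_rate_bound (K := K2) d0) => k n /h2 - /(_ n).
  by rewrite ler_expR lerBlDr sqrrN mulNr mulrN.
exists (C1 + C2); first exact: addr_ge0.
move=> n; set V := \sum_(i < n.+1) y i w ^+ 2.
have M0 : 0 <= Num.sqrt (Num.max 1 (V * ln V)) by exact: sqrtr_ge0.
rewrite mulrDl ler_norml lerNl; apply/andP; split.
  by apply: le_trans (H2 n) _; rewrite lerDr mulr_ge0.
by apply: le_trans (H1 n) _; rewrite lerDl mulr_ge0.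
Qed.

End almost_sure_bound.

(** * From coordinates to vectors *)

Lemma enorm_le_sum (R : realType) (d : nat) (v : 'cV[R]_d) :
  enorm v <= \sum_(i < d) `|v i 0|.
Proof.
rewrite /enorm -[leRHS]ger0_norm ?sumr_ge0// -sqrtr_sqr; apply: ler_wsqrtr.
(* Nonnegativity is carried through the induction to control the cross term of the square. *)
have [] : 0 <= \sum_(i < d) `|v i 0| /\
    \sum_(i < d) v i 0 ^+ 2 <= (\sum_(i < d) `|v i 0|) ^+ 2; last by [].
elim/big_ind2: _ => [|a b e f [a0 ba] [e0 fe]|i _].
- by rewrite expr0n.
- by split; [exact: addr_ge0|nra].
- by rewrite real_normK ?num_real.
Qed.

Lemma tr_sqvar (T : Type) (R : realType) (d : nat) (x : nat -> T -> 'cV[R]_d)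
    (n : nat) (w : T) :
  \tr (sqvar x n w) = \sum_(i < d) \sum_(k < n.+1) x k w i 0 ^+ 2.
Proof.
rewrite exchange_big /sqvar raddf_sum /=; apply: eq_bigr => k _.
rewrite /mxtrace; apply: eq_bigr => i _.
by rewrite mxE big_ord1 mxE expr2.
Qed.

(** The function [t ln t] is not monotone on [[0, 1]], but it is nonpositive there and the maximum
    with 1 hides it; beyond 1 both factors increase. *)
Lemma max1_mul_ln_le (R : realType) (s t : R) :
  0 <= s <= t -> Num.max 1 (s * ln s) <= Num.max 1 (t * ln t).
Proof.
move=> /andP[s0 st]; rewrite ge_max !le_max lexx/=.
have [s1|s1] := leP s 1.
  by rewrite (le_trans (mulr_ge0_le0 s0 (ln_le0 s1)))// ler01.
have t1 : 0 < t by lra.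
rewrite ler_pM ?ln_ge0 ?orbT//; first exact: ltW.
by rewrite ler_ln// posrE; lra.
Qed.

(* [ln 0 = 0] in the library, so [t * ln t] follows the convention 0 log 0 = 0. *)
Theorem proposition2p1 (R : realType) (disp : measure_display)
  (T : measurableType disp) (P : probability T R) (d : nat)
  (D : set 'cV[R]_d) (F : nat -> set (set T)) (x : nat -> T -> 'cV[R]_d) :
  compact D ->
  (convex_hull D)° 0 ->
  filtration F ->
  martingale P F (psum x) ->
  (forall n, {ae P, forall w, D (x n w)}) ->
  {ae P, forall w, bounded_fun (fun n : nat =>
     enorm (psum x n w) /
     Num.sqrt (Num.max 1 (\tr (sqvar x n w) * ln (\tr (sqvar x n w)))))}.
Proof.
move=> cD _ filtrF [adapted_s integrable_s mart_s] xD.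
have Fsigma n : sigma_algebra setT (F n) by case: filtrF.
(* Compactness bounds the maximum norm on [D], hence every coordinate; the maximum with 1 makes [c]
   positive. *)
have [c [c0 Dc]] : exists c : R, 0 < c /\ forall v i, D v -> `|v i 0| <= c.
  have [M [_ MD]] := compact_bounded cD.
  exists (Num.max 1 (M + 1)); split; first by rewrite lt_max ltr01.
  move=> v i Dv; have := MD (Num.max 1 (M + 1)) _ v Dv.
  rewrite lt_max ltrDl ltr01 orbT => /(_ isT); apply: le_trans.
  rewrite [leRHS]/Num.norm/= mx_normrE.
  exact: (le_bigmax _ (fun ij => `|v ij.1 ij.2|) (i, 0)).
have coord n w i : psum x n w i 0 = \sum_(k < n.+1) x k w i 0.
  by rewrite /psum summxE.
have diff n i : (fun w => x n.+1 w i 0) =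
    (fun w => psum x n.+1 w i 0 - psum x n w i 0).
  by apply/funext => w; rewrite !coord big_ord_recr/= addrAC subrr add0r.
have x0E i : (fun w => x 0%N w i 0) = (fun w => psum x 0%N w i 0).
  by apply/funext => w; rewrite coord big_ord1.
have my i n : measurable_wrt (F n) (fun w => x n w i 0).
  case: n => [|n]; first by rewrite x0E.
  rewrite diff; apply/(measurable_wrtE (Fsigma n.+1)).
  apply: measurable_funB; apply/(measurable_wrtE (Fsigma n.+1)) => //.
  exact: (measurable_wrt_filtration filtrF (leqnSn n)).
have iy i n : P.-integrable setT (EFin \o (fun w => x n w i 0)).
  case: n => [|n]; first by rewrite x0E; exact: integrable_s.
  rewrite diff.
  exact: (@integrableB _ _ _ _ _ measurableT _ _
    (integrable_s n.+1 i) (integrable_s n i)).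
have y0 i n A : F n A -> \int[P]_(w in A) x n.+1 w i 0 = 0.
  move=> FA; have mA : measurable A by case: filtrF => _ /(_ n) + _; exact.
  have iA m : P.-integrable A (EFin \o (fun w => psum x m w i 0)).
    by apply: (@integrableS _ _ _ _ setT) => //; exact: integrable_s.
  rewrite (_ : (fun w => _) = (fun w => psum x n.+1 w i 0 - psum x n w i 0)).
    rewrite RintegralB//; apply/eqP; rewrite subr_eq0 /Rintegral.
    by have [_ _ ->] := mart_s n i.
  exact: diff.
have yc i n : {ae P, forall w, `|x n w i 0| <= c}.
  by apply: filterS (xD n) => w; exact: Dc.
have : {ae P, forall w, forall i : 'I_d, exists2 C, 0 <= C & forall n,
    let V := \sum_(k < n.+1) x k w i 0 ^+ 2 in
    `|\sum_(k < n.+1) x k w i 0| <= C * Num.sqrt (Num.max 1 (V * ln V))}.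
  (* There are finitely many coordinates, so one null set serves them all. *)
  apply: filter_forall => i.
  exact: (martingale_diff_bound filtrF c0 (my i) (iy i) (y0 i) (yc i)).
apply: filterS => w Hw.
have /choice[C HC] : forall i : 'I_d, exists C, 0 <= C /\ forall n,
     let V := \sum_(k < n.+1) x k w i 0 ^+ 2 in
     `|\sum_(k < n.+1) x k w i 0| <= C * Num.sqrt (Num.max 1 (V * ln V)).
  by move=> i; have [C C0 h] := Hw i; exists C.
apply: (@bounded_funW _ _ _ (\sum_(i < d) C i)) => n.
have S0 t : 0 < Num.sqrt (Num.max 1 t) :> R.
  by rewrite sqrtr_gt0 lt_max ltr01.
rewrite ger0_norm; last by rewrite divr_ge0 ?sqrtr_ge0.
rewrite ler_pdivrMr//; apply: le_trans (enorm_le_sum _) _.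
rewrite mulr_suml; apply: ler_sum => i _; rewrite coord.
have [Ci0 /(_ n) h] := HC i; apply: le_trans h _.
(* The sum of squares of one coordinate is at most the trace, which sums over all coordinates. *)
rewrite ler_wpM2l//; apply: ler_wsqrtr; apply: max1_mul_ln_le.
rewrite sumr_ge0 => [|k _]; last exact: sqr_ge0.
rewrite tr_sqvar (bigD1 i)//= lerDl sumr_ge0// => j _.
by rewrite sumr_ge0// => k _; exact: sqr_ge0.
Qed.
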